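(* For every cycle $C_n$ with $n\geq 3$, $$3\leq C_s(C_n)\leq 4.$$
   Context: All graphs are finite, simple and undirected. $C_n$ denotes the cycle on $n$ vertices. $N(v)$ denotes the open neighborhood of a vertex $v$, and for $S\subseteq V(G)$ we write $\overline{S}=V(G)\setminus S$. A set $S\subseteq V(G)$ is a dominating set if every vertex of $\overline{S}$ is adjacent to a vertex of $S$. A dominating set $S$ is a super dominating set if for every $u\in\overline{S}$ there exists $v\in S$ with $N(v)\cap\overline{S}=\{u\}$. A super coalition partition of $G$ is a partition $\{A_1,\dots,A_k\}$ of $V(G)$ (into nonempty parts) such that (i) no part $A_i$ is a super dominating set of $G$, and (ii) for every part $A_i$ there is at least one distinct part $A_j$ ($j\neq i$) such that $A_i\cup A_j$ is a super dominating set of $G$. The super coalition number $C_s(G)$ is the maximum cardinality of a super coalition partition of $G$, with $C_s(G)=0$ if $G$ admits no super coalition partition. *)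

(* Defs.v *)
From mathcomp Require Import all_boot.

Set Implicit Arguments.
Unset Strict Implicit.
Unset Printing Implicit Defensive.

Record sgraph := SGraph {
  vertex :> finType;
  adj : rel vertex;
  adj_sym : symmetric adj;
  adj_irr : irreflexive adj
}.

Section SuperCoalition.
Variable G : sgraph.
Implicit Types (S : {set G}) (P : {set {set G}}).

Definition open_nbhd (v : G) : {set G} := [set u | adj v u].

Definition dominating S : bool :=
  [forall u in ~: S, exists v in S, adj u v].

Definition super_dominating S : bool :=
  dominating S &&
  [forall u in ~: S, exists v in S, open_nbhd v :&: ~: S == [set u]].

(* [partition P [set: G]] already requires the parts to be nonempty. *)
Definition super_coalition_partition P : bool :=
  [&& partition P [set: G],
      [forall A in P, ~~ super_dominating A]
    & [forall A in P, exists B in P,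
         (B != A) && super_dominating (A :|: B)]].

(* The maximum over an empty range is 0, which is the convention for graphs
   without any super coalition partition. *)
Definition super_coalition_number : nat :=
  \max_(P : {set {set G}} | super_coalition_partition P) #|P|.

End SuperCoalition.

(* i and j are adjacent iff they are distinct and consecutive modulo n; the
   condition i != j only matters for n = 1, where it excludes a loop. *)
Definition cycle_adj (n : nat) : rel 'I_n :=
  fun i j => (i != j) && ((j == i.+1 %% n :> nat) || (i == j.+1 %% n :> nat)).

Lemma cycle_adj_sym n : symmetric (@cycle_adj n).
Proof. by move=> i j; rewrite /cycle_adj eq_sym orbC. Qed.

Lemma cycle_adj_irr n : irreflexive (@cycle_adj n).
Proof. by move=> i; rewrite /cycle_adj eqxx. Qed.

Definition cycle_graph (n : nat) : sgraph :=
  SGraph (@cycle_adj_sym n) (@cycle_adj_irr n).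

(* Main.v *)
Require Import Defs.
From mathcomp Require Import all_boot.
From mathcomp Require Import ssralg zmodp.

(** In a cycle, S is super dominating iff every u outside S has its two
    successors u + 1, u + 2 or its two predecessors u - 1, u - 2 in S.

    Upper bound: let P have more than four parts.  By the local criterion two
    disjoint super dominating sets cover the cycle, so any two coalitions of P
    share a part; having no isolated part, the coalition graph is then a star.
    Its centre A is not super dominating, which is witnessed by some u, v, w
    outside A such that every partner of A contains u, v or w; so A has at most
    three partners.

    Lower bound: if S = V \ {0, 2} is not super dominating, take the parts
    S, {0}, {2}.  Otherwise shrink S to a minimal super dominating set M; it
    contains 1, and M \ {1}, {1}, V \ M works. *)

Set Implicit Arguments.
Unset Strict Implicit.
Unset Printing Implicit Defensive.

Import GRing.Theory.

(** [A] serves as a partner of both other parts. Nonemptiness is automatic: an empty part would make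
    one of the two unions equal to a single part. *)
Lemma super_coalition_number_ge3 (G : sgraph) (A B C : {set G}) :
    ~~ super_dominating A -> ~~ super_dominating B -> ~~ super_dominating C ->
    super_dominating (A :|: B) -> super_dominating (A :|: C) ->
    [disjoint A & B] -> [disjoint A & C] -> [disjoint B & C] ->
    A :|: B :|: C = [set: G] ->
  3 <= super_coalition_number G.
Proof.
move=> nA nB nC sAB sAC dAB dAC dBC covABC.
have A0 : A != set0 by apply: contraNneq nB => A0; rewrite A0 set0U in sAB.
have B0 : B != set0 by apply: contraNneq nA => B0; rewrite B0 setU0 in sAB.
have C0 : C != set0 by apply: contraNneq nA => C0; rewrite C0 setU0 in sAC.
have neq (X Y : {set G}) : X != set0 -> [disjoint X & Y] -> X != Y.
  by move=> X0; apply: contraTneq => <-; rewrite -setI_eq0 setIid.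
have AB := neq _ _ A0 dAB; have AC := neq _ _ A0 dAC; have BC := neq _ _ B0 dBC.
pose P := [set A; B; C].
have cardP : #|P| = 3.
  by rewrite /P setUC cardsU1 cards2 !inE negb_or ![C == _]eq_sym AC BC AB.
rewrite -cardP /super_coalition_number.
apply: (@leq_bigmax_cond _ (@super_coalition_partition G) (fun P => #|P|)).
apply/and3P; split.
- apply/and3P; split.
  + by rewrite /P /cover -setUA !bigcup_setU !big_set1 setUA covABC.
  + apply/trivIsetP => X Y; rewrite !inE -!orbA.
    by move=> /or3P[]/eqP-> /or3P[]/eqP->; rewrite ?eqxx // disjoint_sym.
  + by rewrite !inE !negb_or ![set0 == _]eq_sym A0 B0 C0.
- by apply/forall_inP => X; rewrite !inE -orbA => /or3P[]/eqP->.
- apply/forall_inP => X; rewrite !inE -orbA => /or3P[]/eqP->; apply/exists_inP.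
  + by exists B; rewrite ?inE ?eqxx ?orbT // eq_sym AB.
  + by exists A; rewrite ?inE ?eqxx ?orbT // AB setUC.
  + by exists A; rewrite ?inE ?eqxx ?orbT // AC setUC.
Qed.

Section Cycle.
Local Open Scope ring_scope.
Variable m : nat.
Local Notation V := 'I_m.+3.
Local Notation sdom := (@super_dominating (cycle_graph m.+3)).
Implicit Types (S A B C D : {set V}) (u v w : V).

Lemma two_neq0 : 1 + 1 != 0 :> V.
Proof. by []. Qed.

Lemma add2_neq u : u + 1 + 1 != u.
Proof. by rewrite -addrA -subr_eq0 addrAC subrr add0r two_neq0. Qed.

Lemma succ_neq u : u + 1 != u.
Proof. by rewrite -{2}[u]addr0 (inj_eq (addrI u)). Qed.

(** With [V] read as the ring of integers modulo n, steps along the cycle become additions of 1. *)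
Lemma cycle_adjE u v : cycle_adj u v = (v == u + 1) || (u == v + 1).
Proof.
have succE w : (w + 1 : V) = w.+1 %% m.+3 :> nat.
  by rewrite /= (modn_small (m := 1)) ?addn1.
rewrite /cycle_adj -!succE !val_eqE andb_idl //.
move=> h; apply: contraTneq h => ->.
by rewrite orbb eq_sym succ_neq.
Qed.

(** A witness for [u] is one of its neighbours [u + 1], [u - 1], and the other neighbour of that
    witness must lie in [S]. *)
Lemma super_dominating_cycleP S :
  reflect (forall u, u \notin S -> (u + 1 \in S) && (u + 1 + 1 \in S)
                                || (u - 1 \in S) && (u - 1 - 1 \in S))
          (sdom S).
Proof.
apply: (iffP andP) => [[_ /forall_inP sS] u uS | loc].
  have /exists_inP[v vS /eqP Nv] := sS u ltac:(by rewrite inE).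
  have nb w : (w == v + 1) || (v == w + 1) -> w != u -> w \in S.
    move=> adj_vw; apply: contraNT => wS.
    have : w \in open_nbhd (G := cycle_graph m.+3) v :&: ~: S.
      by rewrite !inE /= cycle_adjE adj_vw wS.
    by rewrite Nv inE.
  have : u \in [set u] by rewrite set11.
  rewrite -Nv !inE /= cycle_adjE => /andP[/orP[]/eqP e _]; apply/orP.
    right; rewrite {1 2}e addrK vS nb ?subrK ?eqxx ?orbT //.
    by rewrite e -{2}[v](subrK 1) eq_sym add2_neq.
  left; rewrite -e vS nb ?eqxx //.
  by rewrite e add2_neq.
(* The witness is adjacent to [u], so it yields domination as well. *)
have priv u : u \notin S -> exists2 v, v \in S &
    open_nbhd (G := cycle_graph m.+3) v :&: ~: S == [set u].
  move=> uS; case/orP: (loc u uS) => /andP[vS wS].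
    exists (u + 1) => //; apply/eqP/setP => x; rewrite !inE /= cycle_adjE.
    rewrite (inj_eq (addIr 1)) [u == x]eq_sym.
    have [->|_] := eqVneq x u; first by rewrite uS orbT.
    by rewrite orbF; have [->|//] := eqVneq x (u + 1 + 1); rewrite wS.
  exists (u - 1) => //; apply/eqP/setP => x; rewrite !inE /= cycle_adjE subrK.
  have [->|_] := eqVneq x u; first by rewrite uS.
  have [e|//] := eqVneq (u - 1) (x + 1).
  by rewrite e addrK in wS; rewrite wS.
split; apply/forall_inP => u; rewrite inE => /priv[v vS Nv]; apply/exists_inP.
  exists v => //; rewrite adj_sym.
  by have := set11 u; rewrite -(eqP Nv) !inE => /andP[].
by exists v.
Qed.

Lemma super_dominatingS A B : A \subset B -> sdom A -> sdom B.
Proof.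
move=> /subsetP sAB /super_dominating_cycleP sA; apply/super_dominating_cycleP.
move=> u uB; have /sA : u \notin A by apply: contra uB; apply: sAB.
by case/orP => /andP[/sAB-> /sAB->]; rewrite ?orbT.
Qed.

Lemma super_dominatingC1 u : sdom (~: [set u]).
Proof.
apply/super_dominating_cycleP => v; rewrite !inE negbK => /eqP->.
by rewrite add2_neq succ_neq.
Qed.

Lemma super_dominating1 u : ~~ sdom [set u].
Proof.
(* The criterion fails at [u + 1], as neither [u + 1 + 1] nor [u - 1] equals [u]. *)
apply/super_dominating_cycleP => /(_ (u + 1)).
rewrite !inE addrK (negPf (add2_neq u)) (negPf (succ_neq u)) eqxx subr_eq.
by rewrite [u == u + 1]eq_sym (negPf (succ_neq u)) => /(_ isT).
Qed.

(** If [w] is in neither set, disjointness forces them to use opposite sides of [w]. The set using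
    the predecessors then misses [w + 1] and [w], so the criterion at [w + 1] puts [w + 1 + 1] in
    both sets. *)
Lemma disjoint_super_dominatingU S T :
  sdom S -> sdom T -> [disjoint S & T] -> S :|: T = setT.
Proof.
move=> /super_dominating_cycleP sS /super_dominating_cycleP sT dST.
have notboth w : w \in S -> w \in T -> False.
  by move=> wS; rewrite (disjointFr dST wS).
apply/setP => w; rewrite !inE; apply/norP => -[wS wT].
case/orP: (sS w wS) => /andP[wS1 wS2]; case/orP: (sT w wT) => /andP[wT1 wT2].
- exact: notboth wS1 wT1.
- have /sT : w + 1 \notin T by apply/negP; apply: notboth.
  rewrite addrK (negPf wT) /= orbF => /andP[wT3 _].
  exact: notboth wS2 wT3.
- have /sS : w + 1 \notin S by apply/negP => wS3; apply: notboth wS3 wT1.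
  rewrite addrK (negPf wS) /= orbF => /andP[wS3 _].
  exact: notboth wS3 wT2.
- exact: notboth wS1 wT1.
Qed.

(* The three vertices are one that violates the local criterion, one of its two
   successors and one of its two predecessors. *)
Lemma partner_transversal A : ~~ sdom A ->
  exists u v w, [/\ u \notin A, v \notin A, w \notin A &
    forall B, sdom (A :|: B) -> [|| u \in B, v \in B | w \in B]].
Proof.
move=> nA.
have [u uA] : exists2 u, u \notin A & ~~ ((u + 1 \in A) && (u + 1 + 1 \in A)
                               || (u - 1 \in A) && (u - 1 - 1 \in A)).
  apply/exists_inP; apply: contraR nA => /exists_inPn h.
  by apply/super_dominating_cycleP => u uA; have /negPn := h u uA.
rewrite negb_or !negb_and => /andP[succA predA].
have [v vA vP] : exists2 v, v \notin A & (v == u + 1) || (v == u + 1 + 1).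
  by case/orP: succA; [exists (u + 1)|exists (u + 1 + 1)]; rewrite ?eqxx ?orbT.
have [w wA wP] : exists2 w, w \notin A & (w == u - 1) || (w == u - 1 - 1).
  by case/orP: predA; [exists (u - 1)|exists (u - 1 - 1)]; rewrite ?eqxx ?orbT.
exists u, v, w; split=> // B /super_dominating_cycleP sAB.
case: (boolP (u \in B)) => //= uB.
have /sAB : u \notin A :|: B by rewrite inE negb_or uA.
rewrite !inE; case/orP => /andP[h1 h2].
  by case/orP: vP => /eqP ev; [move: h1|move: h2];
    rewrite -ev (negPf vA) /= => ->.
by case/orP: wP => /eqP ew; [move: h1|move: h2];
  rewrite -ew (negPf wA) /= => ->; rewrite orbT.
Qed.

Lemma super_coalition_partition_le4 (P : {set {set V}}) :
  super_coalition_partition (G := cycle_graph m.+3) P -> (#|P| <= 4)%N.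
Proof.
case/and3P => partP /forall_inP nP /forall_inP coalP.
rewrite leqNgt; apply/negP => P_gt4.
have [/eqP coverP trivP P0] := and3P partP.
have disjP A B : A \in P -> B \in P -> A != B -> [disjoint A & B].
  by have /trivIsetP := trivP; apply.
have outside (Q : {set {set V}}) : (#|Q| <= 4)%N -> exists2 E, E \in P & E \notin Q.
  move=> cQ; apply/subsetPn; apply: contraL P_gt4 => /subset_leq_card sPQ.
  by rewrite -leqNgt (leq_trans sPQ).
(* Otherwise two disjoint coalitions would cover the cycle, leaving no room for a fifth part [E]. *)
have meet A B C D : A \in P -> B \in P -> C \in P -> D \in P ->
    sdom (A :|: B) -> sdom (C :|: D) -> A != C -> A != D -> B != C ->
  B = D.
  move=> AP BP CP DP sAB sCD AC AD BC; apply/eqP; apply: contraT => BD.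
  have [|E EP] := outside [set A; B; C; D].
    by rewrite -!setUA !(cardsU1, cards1); do ![case: (_ \notin _)].
  rewrite !inE !negb_or -!andbA => /and4P[EA EB EC ED].
  have [x xE] : exists x, x \in E by apply/set0Pn; apply: contraNneq P0 => <-.
  have : x \in (A :|: B) :|: (C :|: D).
    rewrite (disjoint_super_dominatingU sAB sCD) ?inE //.
    by rewrite -setI_eq0 setIUr !setIUl !setU_eq0 !setI_eq0 !disjP.
  by rewrite !inE !(disjointFr (disjP _ _ EP _ _) xE).
have [A AP starA] :
    exists2 A, A \in P & forall X, X \in P -> X != A -> sdom (A :|: X).
  have [A AP _] := outside set0 ltac:(by rewrite cards0).
  have /exists_inP[B BP /andP[BA sAB]] := coalP A AP.
  have AorB X : X \in P -> X != A -> X != B -> sdom (A :|: X) || sdom (B :|: X).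
    move=> XP XA XB; have /exists_inP[Y YP /andP[YX sXY]] := coalP X XP.
    have [<-|YA] := eqVneq Y A; first by rewrite setUC sXY.
    have [<-|YB] := eqVneq Y B; first by rewrite [Y :|: X]setUC sXY orbT.
    have YeB := meet X Y A B XP YP AP BP sXY sAB XA XB YA.
    by rewrite YeB eqxx in YB.
  case: (boolP [forall X in P, (X != A) ==> sdom (A :|: X)]) => [/forall_inP h|].
    by exists A => // X /h/implyP.
  rewrite negb_forall_in => /exists_inP[X XP]; rewrite negb_imply.
  case/andP => XA nAX.
  (* Some [X] is a partner of [B] but not of [A], so [B] is the centre: a coalition of [A] with [Y]
     must meet that of [B] with [X], which forces [Y = X]. *)
  exists B => // Y YP YB; have [->|YA] := eqVneq Y A; first by rewrite setUC.
  have /orP[sAY|//] := AorB Y YP YA YB.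
  have XB : X != B by apply: contraNneq nAX => ->.
  have sBX : sdom (B :|: X) by have := AorB X XP XA XB; rewrite (negPf nAX).
  have YX := meet A Y B X AP YP BP XP sAY sBX.
  by rewrite YX // eq_sym // eq_sym.
have [u [v [w [uA vA wA hit]]]] := partner_transversal (nP A AP).
(* A fifth part [X] would be a partner of [A] containing none of [u], [v], [w]. *)
have [|X XP] := outside [set A; pblock P u; pblock P v; pblock P w].
  by rewrite -!setUA !(cardsU1, cards1); do ![case: (_ \notin _)].
rewrite !inE !negb_or -!andbA => /and4P[XA Xu Xv Xw].
have pblockX x : x \in X -> pblock P x = X by apply: def_pblock.
by case/or3P: (hit X (starA X XP XA)) => /pblockX eX;
  rewrite eX eqxx in Xu Xv Xw.
Qed.

Lemma super_coalition_cycle_ge3 :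
  (3 <= super_coalition_number (cycle_graph m.+3))%N.
Proof.
pose S : {set V} := ~: [set (0 : V); (1 + 1 : V)].
have two0 : 1 + 1 != 0 :> V := two_neq0.
have [sS|nS] := boolP (sdom S); last first.
  have dS (x : V) : x \notin S -> [disjoint S & [set x]].
    by rewrite disjoint_sym disjoints1.
  apply: (@super_coalition_number_ge3 (cycle_graph m.+3) S
            [set 0 : V] [set 1 + 1 : V]).
  - exact: nS.
  - exact: super_dominating1.
  - exact: super_dominating1.
  - apply: super_dominatingS (super_dominatingC1 (1 + 1)).
    by apply/subsetP => x; rewrite !inE => /negPf->; rewrite orbF orNb.
  - apply: super_dominatingS (super_dominatingC1 0).
    by apply/subsetP => x; rewrite !inE => /negPf->; rewrite orNb.
  - by apply: dS; rewrite !inE eqxx.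
  - by apply: dS; rewrite !inE eqxx orbT.
  - by rewrite disjoints1 inE eq_sym two0.
  - by apply/setP => x; rewrite -setUA !inE orNb.
have [M /minsetP[sM minM] sub_MS] := minset_exists sS.
have locM := super_dominating_cycleP M sM.
have M0 : 0 \notin M by apply/negP => /(subsetP sub_MS); rewrite !inE eqxx.
have M2 : 1 + 1 \notin M.
  by apply/negP => /(subsetP sub_MS); rewrite !inE eqxx orbT.
have M1 : 1 \in M.
  apply: contraT => /locM; rewrite (negPf M2) subrr (negPf M0) /=.
  by [].
(* As [0] and [1 + 1] block each other, [0] relies on its predecessors and [1 + 1] on its
   successors. The resulting members -1 and 3 of [M] make [~: M] fail the criterion at 1. *)
have Mpred : 0 - 1 \in M.
  by have := locM 0 M0; rewrite add0r (negPf M2) andbF /= => /andP[].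
have M3 : 1 + 1 + 1 \in M.
  have := locM _ M2; rewrite addrK subrr (negPf M0) andbF orbF.
  by case/andP.
apply: (@super_coalition_number_ge3 (cycle_graph m.+3) (M :\ (1 : V))
         [set 1 : V] (~: M)).
- by apply/negP => /minM /(_ (subD1set _ _))/setP/(_ 1); rewrite !inE eqxx M1.
- exact: super_dominating1.
- apply/super_dominating_cycleP => /(_ 1); rewrite !inE M1 M3 subrr Mpred.
  by rewrite !andbF => /(_ isT).
- by rewrite setUC setD1K.
(* This union is everything except the vertex 1. *)
- apply: super_dominatingS (super_dominatingC1 1).
  by apply/subsetP => x; rewrite !inE => ->; rewrite orbN.
- by rewrite disjoint_sym disjoints1 !inE eqxx.
- by rewrite disjoints_subset setCK subD1set.
- by rewrite disjoints1 inE M1.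
- by rewrite (setUC (M :\ _)) setD1K // setUCr.
Qed.

End Cycle.

Theorem theorem5p4 (n : nat) (hn : 3 <= n) :
  3 <= super_coalition_number (cycle_graph n) <= 4.
Proof.
case: n hn => [|[|[|m]]] // _; rewrite super_coalition_cycle_ge3 /=.
by apply/bigmax_leqP => P; apply: super_coalition_partition_le4.
Qed.
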